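(* Let $X$ be a reflexive Banach space, $T>0$, and let $\alpha:X\rightrightarrows X^*$ be maximal monotone with $0\in\alpha(0)$. Suppose that $\mathcal E:[0,T]\times X\to(-\infty,+\infty]$ satisfies the lower semicontinuity, coercivity and time-differentiability conditions stated in the context, and the following chain rule: for every $u\in W^{1,1}(0,T;X)$ and $\xi\in L^1(0,T;X^* )$ such that $$\sup_{t\in[0,T]}\mathcal E_t(u(t))<\infty,\quad\xi(t)\in\partial\mathcal E_t(u(t))\ \text{for a.a. }t\in(0,T),\quad\int_0^Tf_\alpha(\dot u(t),-\xi(t))\,dt<\infty$$ (where, by the time-differentiability condition, the first of these guarantees $\int_0^T|\partial_t\mathcal E_t(u(t))|\,dt<\infty$ as well), the map $t\mapsto\mathcal E_t(u(t))$ is absolutely continuous and $$\frac{d}{dt}\mathcal E_t(u(t))=\langle\xi(t),\dot u(t)\rangle+\partial_t\mathcal E_t(u(t))\quad\text{for a.a. }t\in(0,T).$$ Then the following implications hold. (1) If $(u,\xi)\in W^{1,1}(0,T;X)\times L^1(0,T;X^* )$ satisfies the energy identity $$\mathcal E_t(u(t))+\int_0^tf_\alpha(\dot u(s),-\xi(s))\,ds=\mathcal E_0(u(0))+\int_0^t\partial_t\mathcal E_s(u(s))\,ds\quad\text{for all }t\in(0,T],$$ then $(u,\xi)$ is a solution of the doubly nonlinear inclusion $\alpha(\dot u(t))+\partial\mathcal E_t(u(t))\ni0$, in the sense that $$\xi(t)\in(-\alpha(\dot u(t)))\cap\partial\mathcal E_t(u(t))\quad\text{for a.a. }t\in(0,T).$$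 (2) Every solution $(u,\xi)$ in this sense, i.e. every $(u,\xi)\in W^{1,1}(0,T;X)\times L^1(0,T;X^* )$ such that $\xi(t)\in(-\alpha(\dot u(t)))\cap\partial\mathcal E_t(u(t))$ for a.a. $t\in(0,T)$, which in addition satisfies $$\sup_{t\in[0,T]}\mathcal E_t(u(t))<\infty,\qquad\int_0^T|\langle\xi(t),\dot u(t)\rangle|\,dt<\infty,$$ satisfies the energy identity in (1).
   Context: Operators $\alpha:X\rightrightarrows X^*$ are identified with their graphs $\alpha\subset X\times X^*$; $\langle\cdot,\cdot\rangle$ is the duality pairing between $X^*$ and $X$. We write $\mathcal E_t(u)$ for $\mathcal E(t,u)$. Fitzpatrick function: $f_\alpha(\xi,\xi^* ):=\sup\{\langle\xi^*,\xi_0\rangle-\langle\xi_0^*,\xi_0-\xi\rangle:(\xi_0,\xi_0^* )\in\alpha\}$ for $(\xi,\xi^* )\in X\times X^*$. Fréchet subdifferential: $\xi\in\partial\mathcal E_t(u)$ iff $\mathcal E_t(u)<\infty$ and $\mathcal E_t(v)\ge\mathcal E_t(u)+\langle\xi,v-u\rangle+o(\|v-u\|)$ as $v\to u$. Conditions on $\mathcal E$: (Lower semicontinuity) the domain of $\mathcal E$ is $[0,T]\times D$ for some $D\subset X$; $u\mapsto\mathcal E_t(u)$ is lower semicontinuous for all $t\in[0,T]$; there is $C_0>0$ with $\mathcal E_t(u)\ge C_0$ for all $(t,u)\in[0,T]\times D$; the graph of $\partial\mathcal E:[0,T]\times D\rightrightarrows X^*$ is a Borel subset of $[0,T]\times X\times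 X^*$. (Coercivity) $u\mapsto\sup_{t\in[0,T]}\mathcal E_t(u)$ has compact sublevels. (Time-differentiability) for every $u\in D$ the map $t\mapsto\mathcal E_t(u)$ is differentiable with derivative $\partial_t\mathcal E_t(u)$, and there is $C_1>0$ with $|\partial_t\mathcal E_t(u)|\le C_1\mathcal E_t(u)$ for all $t\in[0,T]$, $u\in D$.
   Formalization: In (1) it is additionally assumed that ξ(t)∈∂E_t(u(t)) for a.a. t (without it (1) is false, e.g. X=ℝ, α=id, E=1+u²/2, u=e^{-t/2}, ξ=(√2−1/2)u); the energy identity includes E_0(u(0))<∞ and integrability of ∂_tE_t(u(t)). *)

(* Defs.v *)
From HB Require Import structures.
From mathcomp Require Import all_boot all_order all_algebra.
From mathcomp Require Import all_classical all_reals all_analysis.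

Set Implicit Arguments.
Unset Strict Implicit.
Unset Printing Implicit Defensive.

Import Order.TTheory GRing.Theory Num.Theory.
Import numFieldNormedType.Exports.

Local Open Scope classical_set_scope.
Local Open Scope ring_scope.

(* The topological dual of X as a normed space: continuous linear functionals
   with the operator norm. The duality pairing <xi, x> is written xi x. *)
Section DualPred.
Context {R : realType} {X : normedModType R}.

Definition dual_pred : {pred (X -> R^o)} :=
  [pred f : X -> R^o | `[< linear f /\ continuous f >]].

Lemma dual_predP (f : X -> R^o) :
  reflect (linear f /\ continuous f) (f \in dual_pred).
Proof. exact: asboolP. Qed.

Lemma dual_submod_closed : submod_closed dual_pred.
Proof.
split=> [|a f g /dual_predP[lf cf] /dual_predP[lg cg]]; apply/dual_predP; split.
- by move=> b x y /=; rewrite scaler0 addr0.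
- by move=> x; exact: cst_continuous.
- move=> b x y; rewrite /GRing.add/= /GRing.scale/=.
  by rewrite lf lg /GRing.scale/= !mulrDr !mulrA (mulrC b a) addrACA.
- by move=> x; apply: cvgD; [apply: cvgM; [exact: cvg_cst|exact: cf]|exact: cg].
Qed.

HB.instance Definition _ :=
  GRing.isSubmodClosed.Build R (X -> R^o) dual_pred dual_submod_closed.

End DualPred.

Record dual (R : realType) (X : normedModType R) := Dual {
  dual_fun :> X -> R^o ;
  dual_funP : dual_fun \in dual_pred }.

Section Dual.
Context {R : realType} {X : normedModType R}.
Implicit Types f g : dual X.

HB.instance Definition _ := [isSub for @dual_fun R X].
HB.instance Definition _ := [Choice of dual X by <:].
HB.instance Definition _ := [SubChoice_isSubLmodule of dual X by <:].

Lemma dualD f g x : (f + g) x = f x + g x.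
Proof. by []. Qed.

Lemma dualZ (a : R) f x : (a *: f) x = a * f x.
Proof. by []. Qed.

Lemma dual_linear f : linear f.
Proof. by case: f => f /= /dual_predP[]. Qed.

Lemma dual_continuous f : continuous f.
Proof. by case: f => f /= /dual_predP[]. Qed.

HB.instance Definition _ f :=
  GRing.isLinear.Build R X R^o *:%R (dual_fun f) (dual_linear f).

Definition opnorm f : R := sup [set `|f x| | x in [set x | `|x| <= 1]].

Lemma opnorm_has_sup f : has_sup [set `|f x| | x in [set x | `|x| <= 1]].
Proof.
split; first by exists `|f 0|, 0 => //=; rewrite normr0.
have /linear_bounded_continuous/bounded_funP/(_ 1)[M fM] := @dual_continuous f.
by exists M => _ [x x1 <-]; exact: fM.
Qed.

Lemma le_opnorm f x : `|x| <= 1 -> `|f x| <= opnorm f.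
Proof.
by move=> x1; apply: ub_le_sup; [exact: (opnorm_has_sup f).2|exists x].
Qed.

Lemma opnorm_le f M : (forall x, `|x| <= 1 -> `|f x| <= M) -> opnorm f <= M.
Proof.
move=> fM; apply: ge_sup; first exact: (opnorm_has_sup f).1.
by move=> _ [x x1 <-]; exact: fM.
Qed.

Lemma opnormD f g : opnorm (f + g) <= opnorm f + opnorm g.
Proof.
apply: opnorm_le => x x1; rewrite dualD (le_trans (ler_normD _ _))//.
by rewrite lerD// le_opnorm.
Qed.

Lemma opnormZ_le (a : R) f : opnorm (a *: f) <= `|a| * opnorm f.
Proof.
by apply: opnorm_le => x x1; rewrite dualZ normrM ler_wpM2l// le_opnorm.
Qed.

Lemma opnormZ (a : R) f : opnorm (a *: f) = `|a| * opnorm f.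
Proof.
apply/eqP; rewrite eq_le opnormZ_le/=.
have [->|a0] := eqVneq a 0.
  rewrite normr0 mul0r (le_trans _ (@le_opnorm _ 0 _)) ?normr0//.
have : opnorm (a^-1 *: (a *: f)) <= `|a^-1| * opnorm (a *: f).
  exact: opnormZ_le.
by rewrite scalerA mulVf// scale1r normfV ler_pdivlMl// normr_gt0.
Qed.

Lemma opnorm_eq0 f : opnorm f = 0 -> f = 0.
Proof.
move=> f0; apply/val_inj/funext => x /=.
have [->|x0] := eqVneq x 0; first exact: linear0.
have nx0 : `|x| != 0 by rewrite normr_eq0.
have : `|f (`|x|^-1 *: x)| <= 0.
  by rewrite -f0 le_opnorm// normrZ normfV normr_id mulVf.
rewrite normr_le0 linearZ/= scaler_eq0 invr_eq0 (negbTE nx0)/=.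
by move/eqP.
Qed.

HB.instance Definition _ :=
  @Lmodule_isNormed.Build R (dual X) opnorm opnormD opnormZ opnorm_eq0.

End Dual.

Definition reflexive_space (R : realType) (X : normedModType R) :=
  forall Phi : dual (dual X), exists x : X, forall xi : dual X, Phi xi = xi x.

(* Operators from X to its dual are identified with their graphs. *)
Section Operators.
Context {R : realType} {X : normedModType R}.
Implicit Types alpha beta : set (X * dual X).

Definition monotone alpha :=
  forall p q, alpha p -> alpha q -> 0 <= (p.2 - q.2) (p.1 - q.1).

Definition maximal_monotone alpha :=
  monotone alpha /\
  forall beta, monotone beta -> alpha `<=` beta -> beta = alpha.

Definition fitzpatrick alpha (x : X) (xi : dual X) : \bar R :=
  ereal_sup [set (xi p.1 - p.2 (p.1 - x))%:E | p in alpha].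

Definition frechet_subdiff (F : X -> \bar R) (u : X) : set (dual X) :=
  [set xi | (F u < +oo)%E /\
    exists2 r : X -> R, r =o_ u (fun v => v - u) &
      \forall v \near u, (F u + (xi (v - u))%:E + (r v)%:E <= F v)%E].

End Operators.

(* The classes of functions making up L^1(0,T;V) are represented by functions
   on R that are strongly measurable on [0,T], i.e. limits on [0,T] of simple
   Borel functions at every point; every class of a.e. equal strongly
   measurable functions contains such a representative. Values outside [0,T]
   are irrelevant. *)
Section Bochner.
Context {R : realType} {V : normedModType R}.
Local Notation mu := (@lebesgue_measure R).
Implicit Types (A : set R) (f s : R -> V).

Definition simple_fun s :=
  finite_set (range s) /\ forall x, measurable (s @^-1` [set x]).

Definition simple_integral A s : V :=
  \sum_(x \in range s) fine (mu (A `&` s @^-1` [set x])) *: x.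

Definition strongly_measurable A f :=
  exists2 s : nat -> R -> V, forall n, simple_fun (s n) &
    forall t, A t -> s n t @[n --> \oo] --> f t.

(* x is the Bochner integral of f over A, for A of finite measure *)
Definition is_bochner_integral A f (x : V) :=
  strongly_measurable A f /\
  exists s : nat -> R -> V, [/\ forall n, simple_fun (s n),
    (\int[mu]_(t in A) `|f t - s n t|%:E @[n --> \oo] --> 0)%E &
    simple_integral A (s n) @[n --> \oo] --> x].

Definition L1 (T : R) f := strongly_measurable `[0, T] f /\
  (\int[mu]_(t in `[0%R, T]) `|f t|%:E < +oo)%E.

(* phi is in C_c^oo (]0, T[) *)
Definition test_fun (T : R) (phi : R -> R) :=
  (forall n t, derivable (derive1n n phi) t 1) /\
  exists a b, [/\ 0 < a, b < T & forall t, ~~ (a <= t <= b) -> phi t = 0].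

(* u is (the continuous representative of) an element of W^{1,1}(0,T;V) and du
   represents its distributional derivative *)
Definition W11 (T : R) (u du : R -> V) :=
  [/\ L1 T u, L1 T du, {within `[0, T], continuous u} &
    forall phi, test_fun T phi -> exists2 x : V,
      is_bochner_integral `[0, T] (fun t => derive1 phi t *: u t) x &
      is_bochner_integral `[0, T] (fun t => phi t *: du t) (- x)].

End Bochner.

Definition abs_continuous (R : realType) (a b : R) (g : R -> R) :=
  forall e, 0 < e -> exists2 d, 0 < d &
    forall (n : nat) (l r : 'I_n -> R),
      (forall i, a <= l i /\ l i <= r i /\ r i <= b) ->
      (forall i j, i != j -> r i <= l j \/ r j <= l i) ->
      \sum_(i < n) (r i - l i) < d ->
      \sum_(i < n) `|g (r i) - g (l i)| < e.

Section Energy.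
Context {R : realType} {X : normedModType R}.
Local Notation mu := (@lebesgue_measure R).
Implicit Types (T t : R) (E : R -> X -> \bar R) (D : set X) (u du : R -> X)
  (xi : R -> dual X) (alpha : set (X * dual X)).

Definition diff_quotient E t (x : X) (s : R) : R :=
  (fine (E s x) - fine (E t x)) / (s - t).

(* one-sided at the endpoints; only meaningful for x in the domain of E *)
Definition partial_t T E t (x : X) : R :=
  lim (diff_quotient E t x s @[s --> within `[0, T] t^']).

Definition energy_lsc T E D :=
  [/\ forall t x, 0 <= t <= T -> D x <-> (E t x < +oo)%E,
      forall t, 0 <= t <= T -> lower_semicontinuous (E t),
      exists2 C0 : R, 0 < C0 &
        forall t x, 0 <= t <= T -> D x -> (C0%:E <= E t x)%E &
      <<s [set A : set (R * X * dual X) | open A] >>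
        [set p | [/\ 0 <= p.1.1 <= T, D p.1.2 &
                     frechet_subdiff (E p.1.1) p.1.2 p.2]] ].

Definition energy_coercive T E :=
  forall c : R,
    compact [set x | (ereal_sup [set E t x | t in `[0%R, T]] <= c%:E)%E].

Definition energy_time_diff T E D :=
  (forall t x, 0 <= t <= T -> D x ->
     cvg (diff_quotient E t x s @[s --> within `[0, T] t^'])) /\
  exists2 C1 : R, 0 < C1 & forall t x, 0 <= t <= T -> D x ->
     (`|partial_t T E t x|%:E <= C1%:E * E t x)%E.

Definition bounded_energy T E u :=
  (ereal_sup [set E t (u t) | t in `[0%R, T]] < +oo)%E.

Definition chain_rule T E alpha :=
  forall u du xi, W11 T u du -> L1 T xi -> bounded_energy T E u ->
    {ae mu, forall t, 0 < t < T -> frechet_subdiff (E t) (u t) (xi t)} ->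
    (\int[mu]_(t in `[0%R, T]) fitzpatrick alpha (du t) (- xi t)%R < +oo)%E ->
    abs_continuous 0 T (fun t => fine (E t (u t))) /\
    {ae mu, forall t, 0 < t < T ->
      is_derive t 1 (fun s => fine (E s (u s)))
        (xi t (du t) + partial_t T E t (u t))}.

(* The first two clauses say that the right-hand side is meaningful and finite;
   since the Fitzpatrick term is nonnegative, they make every term finite. *)
Definition energy_identity T E alpha u du xi :=
  [/\ (E 0%R (u 0%R) < +oo)%E,
      mu.-integrable `[0, T] (fun s => (partial_t T E s (u s))%:E) &
      forall t, 0 < t <= T ->
        (E t (u t) + \int[mu]_(s in `[0%R, t])
                       fitzpatrick alpha (du s) (- xi s)%R =
         E 0%R (u 0%R) + \int[mu]_(s in `[0%R, t]) (partial_t T E s (u s))%:E)%E].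

Definition dni_solution T E alpha u du xi :=
  {ae mu, forall t, 0 < t < T ->
    alpha (du t, - xi t) /\ frechet_subdiff (E t) (u t) (xi t)}.

End Energy.

(* Main.v *)
Require Import Defs.
From HB Require Import structures.
From mathcomp Require Import all_boot all_order all_algebra.
From mathcomp Require Import all_classical all_reals all_analysis.
From mathcomp Require Import measurable_realfun lra.

Set Implicit Arguments.
Unset Strict Implicit.
Unset Printing Implicit Defensive.

Import Order.TTheory GRing.Theory Num.Theory.
Import numFieldNormedType.Exports.

Local Open Scope classical_set_scope.
Local Open Scope ring_scope.

(** The Fitzpatrick function of a maximal monotone graph dominates the duality
    pairing, with equality exactly on the graph ([fitzpatrick_ge],
    [fitzpatrick_eq_mem]). The inclusion is therefore the scalar equality
    f(u', -xi) = - <xi, u'> almost everywhere, and the chain rule turns this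
    equality into the energy identity and back.

    From a solution to the energy identity: the dissipation f(u', -xi) equals
    - <xi, u'> almost everywhere, so it is integrable and the chain rule
    applies; integrating the derivative <xi, u'> + d_t E of the absolutely
    continuous energy over [0, t] gives the identity.

    From the energy identity to a solution: the identity bounds the energy and
    the dissipation, so the chain rule applies. The integrability of <xi, u'>
    is not known beforehand, only the inequality <xi, u'> + f >= 0. Put
    m = min (|f + <xi, u'>|, 1). Then d_t E - f + m is integrable and lies
    below the derivative of the energy; integrating this inequality
    ([abs_continuous_le_Rintegral]) and comparing with the identity at time T
    gives int m <= 0, whence f + <xi, u'> = 0 almost everywhere.

    Two pieces of theory support this. The first is the fundamental theorem of
    calculus for absolutely continuous functions, obtained from a one-sided
    inequality by Gordon's argument: local increments are compared at every
    point of [a, b], with the derivative off a null set and with absolute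
    continuity on a small open neighbourhood of it, and Cousin's lemma
    ([cousin]) assembles them. The second is Borel measurability: a strongly
    measurable function composed with a lower semicontinuous one is measurable
    ([measurable_lsc_comp]), which covers the dissipation and, through the
    continuity of the energy in time, the power d_t E_t(u(t))
    ([measurable_partial_t]). *)

(** * Absolutely continuous functions and the fundamental theorem of calculus *)

(** Cousin's lemma: the supremum of the x such that Q a x holds is attained and
    cannot lie before b. *)
Lemma cousin (R : realType) (a b : R) (Q : R -> R -> Prop) : a <= b ->
  (forall u v w, a <= u -> u <= v -> v <= w -> w <= b ->
     Q u v -> Q v w -> Q u w) ->
  (forall x, a <= x <= b -> exists2 d, 0 < d &
     forall u v, a <= u -> u <= x -> x <= v -> v <= b ->
       x - d < u -> v < x + d -> Q u v) ->
  Q a b.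
Proof.
move=> ab Qadd Qloc.
pose S := [set x | a <= x <= b /\ Q a x].
have Sa : S a.
  split; first by rewrite lexx ab.
  have [|d d0 Hd] := Qloc a; first by rewrite lexx ab.
  by apply: Hd => //; lra.
have Sub : has_ubound S by exists b => x [/andP[]].
have supS : has_sup S by split => //; exists a.
pose s := sup S.
have as_ : a <= s by exact: ub_le_sup.
have sb : s <= b by apply: ge_sup; [exists a|move=> x [/andP[]]].
have [|d d0 Hd] := Qloc s; first by rewrite as_ sb.
have [x [/andP[ax xb] Qax] sdx] := sup_adherent d0 supS.
have xs : x <= s by apply: ub_le_sup => //; split => //; rewrite ax.
have Sy y : s <= y -> y <= b -> y < s + d -> Q a y.
  by move=> sy yb ysd; apply: (Qadd a x y) => //; [lra|apply: Hd].
have [sdb|bsd] := leP (s + d / 2) b; last by apply: Sy => //; lra.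
have : s + d / 2 <= s.
  by apply: ub_le_sup => //; split; [lra|apply: Sy => //; lra].
lra.
Qed.

Section AC.
Context {R : realType}.
Local Notation mu := (@lebesgue_measure R).

Lemma integrable_EFinN (A : set R) (k : R -> R) : measurable A ->
  mu.-integrable A (EFin \o k) -> mu.-integrable A (EFin \o (\- k)).
Proof.
move=> mA ik; rewrite (_ : _ \o _ = -%E \o (EFin \o k)); last exact/funext.
exact: integrableN.
Qed.

Lemma RintegralN (A : set R) (k : R -> R) : measurable A ->
  mu.-integrable A (EFin \o k) ->
  \int[mu]_(t in A) (\- k) t = - \int[mu]_(t in A) k t.
Proof.
move=> mA ik; rewrite -mulN1r -RintegralZl//; apply: eq_Rintegral => t _ /=.
by rewrite mulN1r.
Qed.

(** Sequences of intervals, unlike families indexed by ordinals, can be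
    concatenated, which is how they arise from adjacent subdivisions. *)
Lemma abs_continuous_seq (a b : R) (g : R -> R) (e : R) :
  abs_continuous a b g -> 0 < e ->
  exists2 d, 0 < d & forall s : seq (R * R),
    all (fun p => (a <= p.1) && (p.1 <= p.2) && (p.2 <= b)) s ->
    pairwise (fun p q : R * R => p.2 <= q.1) s ->
    \sum_(p <- s) (p.2 - p.1) < d -> \sum_(p <- s) `|g p.2 - g p.1| < e.
Proof.
move=> gAC e0; have [d d0 Hd] := gAC e e0; exists d => // s sab sP.
rewrite (big_nth 0) big_mkord => sd.
rewrite (big_nth 0) big_mkord.
apply: (Hd (size s) (fun i => (nth 0 s i).1) (fun i => (nth 0 s i).2)) => //.
- move=> i; have /allP/(_ (nth 0 s i)) := sab.
  by rewrite mem_nth// => /(_ isT)/andP[/andP[]].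
- move=> i j; have /(pairwiseP 0) sP' := sP.
  rewrite -val_eqE/= neq_ltn => /orP[ij|ji]; [left|right];
    by apply: sP' => //; rewrite inE.
Qed.

(** Straddling intervals, rather than intervals starting at x, are what a tagged
    subdivision produces; the increment splits at the tag x. *)
Lemma is_derive_ge0_straddle (f : R -> R) (x d e : R) :
  is_derive x 1 f d -> 0 <= d -> 0 < e -> exists2 c, 0 < c &
    forall u v, u <= x -> x <= v -> x - c < u -> v < x + c ->
      - (e * (v - u)) <= f v - f u.
Proof.
move=> [df fd] d0 e0.
have : h^-1 *: (f (h *: 1 + x) - f x) @[h --> 0^'] --> d.
  by rewrite -fd; exact: df.
move=> /cvgrPdist_lt/(_ e e0)/nbhs_ballP[c /= c0 Hc].
have {}Hc h : `|h| < c -> h != 0 -> `|d - h^-1 * (f (h + x) - f x)| < e.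
  move=> hc h0; have := Hc h; rewrite /ball/= sub0r normrN => /(_ hc h0).
  by rewrite /GRing.scale/= mulr1.
exists c => // u v ux xv xcu vxc.
have Hv : - (e * (v - x)) <= f v - f x.
  have [->|vx] := eqVneq v x; first by lra.
  have vx0 : 0 < v - x by rewrite subr_gt0 lt_def vx.
  have := Hc (v - x); rewrite gtr0_norm// subrK => /(_ ltac:(lra)).
  rewrite gt_eqF// => /(_ isT); rewrite ltr_norml => /andP[_ h].
  have : - e <= (v - x)^-1 * (f v - f x) by lra.
  by rewrite ler_pdivlMl// mulrN mulrC.
have Hu : - (e * (x - u)) <= f x - f u.
  have [->|xu] := eqVneq x u; first by lra.
  have ux0 : 0 < x - u by rewrite subr_gt0 lt_def xu.
  have := Hc (u - x); rewrite distrC gtr0_norm// subrK => /(_ ltac:(lra)).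
  rewrite lt_eqF; last by rewrite subr_lt0 -subr_gt0.
  move=> /(_ isT).
  rewrite ltr_norml => /andP[_].
  rewrite -(opprB x u) invrN mulNr -mulrN opprB => h.
  have : - e <= (x - u)^-1 * (f x - f u) by lra.
  by rewrite ler_pdivlMl// mulrN mulrC.
lra.
Qed.

(** With F a primitive of k, the function g - F has a nonnegative derivative off
    a null set N. Off N, a short interval contributes at least - e times its
    length to g - F. The intervals tagged in N lie in an open set U of small
    measure: their increments of g are small in total by absolute continuity,
    and their increments of F by absolute continuity of the integral. The
    one-sided form serves when the derivative is bounded below by an integrable
    function but not yet known to be integrable. *)
Lemma abs_continuous_le_Rintegral (a b : R) (g k : R -> R) : a <= b ->
  abs_continuous a b g -> mu.-integrable `[a, b] (EFin \o k) ->
  {ae mu, forall t, a < t < b -> exists2 d, is_derive t 1 g d & k t <= d} ->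
  \int[mu]_(t in `[a, b]) k t <= g b - g a.
Proof.
move=> ab gAC ik gk.
pose K := k \_ `[a, b].
have iK : mu.-integrable setT (EFin \o K).
  rewrite /K -restrict_EFin; apply: (integrable_mkcond _ _).1 => //.
have iKA A : measurable A -> mu.-integrable A (EFin \o K).
  by move=> mA; exact: integrableS iK.
pose F x := \int[mu]_(t in `]-oo, x]) K t.
pose J A := \int[mu]_(t in A) `|K t|.
have Fuv u v : u <= v -> F v - F u = \int[mu]_(t in `]u, v]) K t.
  by move=> uv; rewrite /F Rintegral_itvB//; exact: iKA.
have Fab : F b - F a = \int[mu]_(t in `[a, b]) k t.
  rewrite Fuv// Rintegral_itv_obnd_cbnd; last exact: iKA.
  by apply: eq_Rintegral => x xab; rewrite /K patchE xab.
have J0 A : 0 <= J A by exact: Rintegral_ge0.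
have JU A B : measurable A -> measurable B -> [disjoint A & B] ->
    J (A `|` B) = J A + J B.
  move=> mA mB AB; apply: Rintegral_setU => //.
  by apply: integrable_norm; apply: iKA; exact: measurableU.
have aeGF : {ae mu, forall x, a < x < b ->
    exists2 d, is_derive x 1 (g - F) d & 0 <= d}.
  have := @FTC1Ny R K (fun y => iKA _ _) (integrable_locally _ ik).
  move=> /(_ (fun=> measurable_itv _) (measurable_itv _)).
  move: gk; apply: filterS2; first exact: (ae_filter_ringOfSetsType mu).
  move=> x gx [dF F'x] axb; have [d gd kd] := gx axb.
  have KF : is_derive x 1 F (K x)
    by apply: DeriveDef; [exact: dF|rewrite -derive1E; exact: F'x].
  exists (d - K x); first exact: is_deriveB.
  by rewrite /K patchE mem_set/= ?subr_ge0// in_itv/=; lra.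
case: aeGF => N [mN N0 GFN].
(* the derivative is controlled in the open interval only, so the endpoints
   join the exceptional set *)
pose N' := N `|` [set a] `|` [set b].
have mN' : measurable N' by apply: measurableU => //; apply: measurableU.
have mu1 x : mu [set x] = 0%E by exact: lebesgue_measure_set1.
have N'0 : mu N' = 0%E.
  rewrite (measureU0 _ _ (mu1 b)) ?(measureU0 _ _ (mu1 a))//.
  exact: measurableU.
have good x : ~ N' x -> a <= x <= b ->
    exists2 d, is_derive x 1 (g - F) d & 0 <= d.
  move=> N'x axb; have xa : x != a.
    by apply/eqP => xa; apply: N'x; left; right.
  have xb : x != b by apply/eqP => xb; apply: N'x; right.
  apply: contrapT => H; apply: N'x; left; left; apply: GFN => /= H'.
  by apply: H; apply: H'; rewrite !lt_def xa (eq_sym b) xb/=.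
suff small e : 0 < e -> F b - F a <= g b - g a + e * (b - a) + 2 * e.
  rewrite -Fab; apply/ler_addgt0Pr => e e0.
  have c0 : 0 < b - a + 2 by lra.
  have := small (e / (b - a + 2)) (divr_gt0 e0 c0).
  rewrite -addrA (mulrC 2) -mulrDr mulfVK// gt_eqF//.
move=> e0.
have [d1 d10 gd1] := abs_continuous_seq gAC e0.
have [d2 [d20 Kd2]] := integral_normr_continuous iK e0.
have [||U [oU N'U muUN]] := @lebesgue_regularity_outer R N' (Num.min d1 d2) mN'.
- by rewrite [X in (X < _)%E]N'0 ltry.
- by rewrite lt_min d10 d20.
have mU : measurable U by exact: open_measurable.
have muU : (mu U < (Num.min d1 d2)%:E)%E.
  apply: le_lt_trans muUN.
  rewrite -[U in leLHS](setDUK N'U) setUC measureU0//; exact: measurableD.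
(* s collects the subintervals tagged in N'; the bounds by the measure of, and
   the integral over, U within ]u, v] are additive in the interval *)
pose Q u v := exists s : seq (R * R), [/\
  all (fun p => (u <= p.1) && (p.1 <= p.2) && (p.2 <= v)) s,
  pairwise (fun p q : R * R => p.2 <= q.1) s,
  ((\sum_(p <- s) (p.2 - p.1))%:E <= mu (U `&` `]u, v]))%E &
  F v - F u <= g v - g u + e * (v - u) +
    \sum_(p <- s) `|g p.2 - g p.1| + J (U `&` `]u, v])].
have mUI u v : measurable (U `&` `]u, v]) by exact: measurableI.
have [s [sab sP smu Hs]] : Q a b.
  apply: cousin => // [u v w au uv vw wb|x axb].
    move=> [s [suv sP smu Hs]] [r [rvw rP rmu Hr]].
    have UE : U `&` `]u, w] = (U `&` `]u, v]) `|` (U `&` `]v, w]).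
      by rewrite -setIUr; congr (_ `&` _); rewrite -itv_bndbnd_setU ?bnd_simp.
    have U0 : (U `&` `]u, v]) `&` (U `&` `]v, w]) = set0.
      apply/seteqP; split=> // x [[_ /=]]; rewrite !in_itv/= => /andP[_ xv].
      by move=> [_ /andP[/lt_le_trans/(_ xv)]]; rewrite ltxx.
    exists (s ++ r); split.
    - rewrite all_cat; apply/andP; split.
        apply: sub_all suv => p /andP[-> pv].
        exact: le_trans pv vw.
      apply: sub_all rvw => p /andP[/andP[vp ->] ->].
      by rewrite (le_trans uv vp).
    - rewrite pairwise_cat sP rP !andbT; apply/allrelP => p q ps qr.
      have /allP/(_ p ps)/andP[_ pv] := suv.
      have /allP/(_ q qr)/andP[/andP[vq _] _] := rvw.
      exact: le_trans pv vq.
    - have muUE : mu (U `&` `]u, w]) =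
          (mu (U `&` `]u, v]) + mu (U `&` `]v, w]))%E.
        by rewrite UE; exact: (measureU mu (mUI u v) (mUI v w) U0).
      by rewrite big_cat/= EFinD muUE; apply: leeD.
    - rewrite big_cat/= UE (JU _ _ (mUI u v) (mUI v w)); last exact/disj_set2P.
      by clear -Hs Hr; lra.
  have [N'x|/good /(_ axb)[d Gd dge0]] := pselect (N' x).
    have /nbhs_ballP[c /= c0 cU] := open_nbhs_nbhs (conj oU (N'U _ N'x)).
    exists c => // u v au ux xv vb xcu vxc.
    have uvU : `]u, v] `<=` U.
      move=> y /=; rewrite in_itv/= => /andP[uy yv]; apply: cU.
      by rewrite /ball/= ltr_norml; lra.
    have UE : U `&` `]u, v] = `]u, v]%classic by exact/setIidr.
    have uv : u <= v by exact: le_trans ux xv.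
    exists [:: (u, v)]; rewrite /= !big_seq1/= UE !lexx uv; split => //.
      rewrite lebesgue_measure_itv/= lte_fin; case: ltP => // vu.
      by rewrite lee_fin subr_le0.
    rewrite Fuv//; apply: (@le_trans _ _ (J `]u, v]%classic)).
      apply: le_trans (ler_norm _) _; apply: le_normr_Rintegral => //.
      exact: iKA.
    rewrite -[leLHS]add0r lerD2r addrAC addr_ge0//.
      by rewrite -lerBlDl sub0r opprB distrC ler_norm.
    by rewrite mulr_ge0 ?subr_ge0// ltW.
  have [c c0 Hc] := is_derive_ge0_straddle Gd dge0 e0.
  exists c => // u v au ux xv vb xcu vxc.
  exists [::]; rewrite !big_nil/=; split => //.
  have := Hc u v ux xv xcu vxc; rewrite !fctE => H.
  have := J0 (U `&` `]u, v]); lra.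
have muUab : (mu (U `&` `]a, b]) < (Num.min d1 d2)%:E)%E.
  apply: le_lt_trans muU; apply: le_measure; rewrite ?inE.
  - exact: mUI.
  - exact: mU.
  - exact: subIsetl.
have sd1 : \sum_(p <- s) (p.2 - p.1) < d1.
  rewrite -lte_fin (le_lt_trans smu)// (lt_le_trans muUab)// lee_fin.
  by rewrite ge_min lexx.
have Jd2 : J (U `&` `]a, b]) < e.
  apply: Kd2; first exact: mUI.
  apply: (lt_le_trans muUab); rewrite lee_fin.
  by rewrite ge_min lexx orbT.
have := gd1 s sab sP sd1; lra.
Qed.

Lemma abs_continuousN (a b : R) (g : R -> R) :
  abs_continuous a b g -> abs_continuous a b (\- g).
Proof.
move=> gAC e /gAC[d d0 Hd]; exists d => // n l r lr dis lrd.
under eq_bigr do rewrite /= -opprD normrN.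
exact: Hd lrd.
Qed.

Lemma abs_continuousS (a b c d : R) (g : R -> R) : a <= c -> d <= b ->
  abs_continuous a b g -> abs_continuous c d g.
Proof.
move=> ac db gAC e /gAC[m m0 Hm]; exists m => // n l r lr dis lrd.
by apply: Hm lrd => // i; have [? [? ?]] := lr i; split; [lra|split; lra].
Qed.

Lemma abs_continuous_Rintegral (a b : R) (g k : R -> R) : a <= b ->
  abs_continuous a b g -> mu.-integrable `[a, b] (EFin \o k) ->
  {ae mu, forall t, a < t < b -> is_derive t 1 g (k t)} ->
  \int[mu]_(t in `[a, b]) k t = g b - g a.
Proof.
move=> ab gAC ik gk; apply/eqP; rewrite eq_le; apply/andP; split.
  apply: abs_continuous_le_Rintegral => //.
  move: gk; apply: filterS; first exact: (ae_filter_ringOfSetsType mu).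
  by move=> t H /H gt; exists (k t).
have ikN := integrable_EFinN (measurable_itv _) ik.
rewrite -lerN2 -RintegralN// opprB addrC -[X in _ <= _ + X]opprK.
apply: (abs_continuous_le_Rintegral ab (abs_continuousN gAC) ikN).
move: gk; apply: filterS; first exact: (ae_filter_ringOfSetsType mu).
by move=> t gt /gt gkt; exists (- k t) => //; exact: is_deriveN.
Qed.

End AC.

(** * Measurability of compositions with strongly measurable functions *)

Section StronglyMeasurable.
Context {R : realType}.

Lemma simple_fun_preimage (V : normedModType R) (s : R -> V) (B : set V) :
  simple_fun s -> measurable (s @^-1` B).
Proof.
move=> [fs ms].
have -> : s @^-1` B = \bigcup_(x in range s `&` B) (s @^-1` [set x]).
  apply/seteqP; split=> [t Bt|t [x [_ Bx] /= ->]//].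
  by exists (s t) => //; split => //; exists t.
by apply: fin_bigcup_measurable => //; exact: finite_setIl.
Qed.

(** A limit of s n t lies in the open set U iff, for some k, s n t eventually
    lies in the set W k of points whose 1/(k+1)-ball is inside U. All preimages
    under s n are measurable because s n has finite range. *)
Lemma strongly_measurable_preimage (V : normedModType R) (A : set R)
    (f : R -> V) (U : set V) :
  measurable A -> strongly_measurable A f -> open U ->
  measurable (A `&` f @^-1` U).
Proof.
move=> mA [s ss sf] oU.
pose W k := [set x : V | forall y, `|x - y| < k.+1%:R^-1 -> U y].
have -> : A `&` f @^-1` U =
    A `&` \bigcup_k \bigcup_N \bigcap_(n >= N) (s n @^-1` W k).
  apply/seteqP; split=> [t [At Uft]|t [At [k _ [N _ HN]]]]; split => //.
    have /nbhs_ballP[e /= e0 eU] := open_nbhs_nbhs (conj oU Uft).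
    have e20 : 0 < e / 2 by rewrite divr_gt0.
    have [k ke] : exists k, (k.+1%:R^-1 : R) < e / 2.
      have [N _ /(_ N (leqnn N))] := near_infty_natSinv_lt (PosNum e20).
      by exists N.
    have := sf t At => /cvgrPdist_lt/(_ _ e20)[N _ HN].
    exists k => //; exists N => // n /= Nn y ny; apply: eU.
    rewrite -ball_normE/= -(subrKA (s n t)).
    rewrite (le_lt_trans (ler_normD _ _))// [e]splitr ltrD//; first exact: HN.
    exact: lt_trans ny ke.
  have k0 : 0 < (k.+1%:R^-1 : R) by rewrite invr_gt0.
  have := sf t At => /cvgrPdist_lt/(_ _ k0)[M _ HM].
  apply: (HN (maxn M N)); first by rewrite /= leq_maxr.
  by rewrite distrC; apply: HM; rewrite /= leq_maxl.
apply: measurableI => //; apply: bigcup_measurable => k _.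
apply: bigcup_measurable => N _; apply: bigcap_measurable.
  by exists N => /=.
by move=> n _; exact: simple_fun_preimage.
Qed.

Lemma measurable_lsc_comp (V : normedModType R) (A : set R)
    (f : R -> V) (g : V -> \bar R) :
  measurable A -> strongly_measurable A f -> lower_semicontinuous g ->
  measurable_fun A (fun t => g (f t)).
Proof.
move=> mA mf /lower_semicontinuousP lg.
apply: (measurability _ (ErealGenOInfty.measurableE R)).
move=> /= _ [_ [c ->]] <-; rewrite preimage_itvoy.
exact: (strongly_measurable_preimage mA mf (lg c)).
Qed.

Lemma measurable_continuous_comp (V : normedModType R) (A : set R)
    (f : R -> V) (g : V -> R) :
  measurable A -> strongly_measurable A f -> continuous g ->
  measurable_fun A (fun t => g (f t)).
Proof.
move=> mA mf cg; apply/measurable_EFinP.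
apply: (@measurable_lsc_comp _ _ f (EFin \o g)) => // x c cx.
rewrite /= lte_fin in cx.
exists [set y | c < g y]; first by apply: (cvgr_gt (g x)) => //; exact: cg.
by move=> y /=; rewrite lte_fin.
Qed.

Lemma strongly_measurable_pair (V W : normedModType R) (A : set R)
    (f : R -> V) (g : R -> W) :
  strongly_measurable A f -> strongly_measurable A g ->
  strongly_measurable A (fun t => (f t, g t)).
Proof.
move=> [s ss sf] [r sr rg]; exists (fun n t => (s n t, r n t)) => [n|t At].
  split; last first.
    move=> [x y]; rewrite (_ : _ @^-1` _ =
      s n @^-1` [set x] `&` r n @^-1` [set y]).
      by apply: measurableI; [exact: (ss n).2|exact: (sr n).2].
    by apply/seteqP; split => t /= [] // -> ->.
  apply: (@sub_finite_set _ _ (range (s n) `*` range (r n))).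
    by move=> _ [t _ <-]; split; exists t.
  by apply: finite_setX; [exact: (ss n).1|exact: (sr n).1].
by apply: cvg_pair; [exact: sf|exact: rg].
Qed.

Lemma strongly_measurableN (V : normedModType R) (A : set R) (f : R -> V) :
  strongly_measurable A f -> strongly_measurable A (fun t => - f t).
Proof.
move=> [s ss sf]; exists (fun n t => - s n t) => [n|t At]; last first.
  by apply: cvgN; exact: sf.
split; last first.
  move=> x; rewrite (_ : _ @^-1` _ = s n @^-1` [set - x]).
    exact: (ss n).2.
  by apply/seteqP; split=> t /= => [<-|->]; rewrite opprK.
apply: (@sub_finite_set _ _ (-%R @` range (s n))).
  by move=> _ [t _ <-]; exists (s n t) => //; exists t.
by apply: finite_image; exact: (ss n).1.
Qed.

End StronglyMeasurable.

Section Pairing.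
Context {R : realType} {X : normedModType R}.

Lemma ler_dual (f : dual X) (x : X) : `|f x| <= `|f| * `|x|.
Proof.
have [->|x0] := eqVneq x 0; first by rewrite linear0 !normr0 mulr0.
have nx0 : 0 < `|x| by rewrite normr_gt0.
have : `|f (`|x|^-1 *: x)| <= `|f|.
  by rewrite le_opnorm// normrZ normfV normr_id mulVf// gt_eqF.
by rewrite linearZ/= normrZ normfV normr_id mulrC ler_pdivrMr.
Qed.

Lemma pairing_continuous : continuous (fun p : X * dual X => p.2 p.1 : R).
Proof.
move=> -[x0 f0]; apply/cvgrPdist_lt => e e0 /=.
pose M := `|x0| + 1 + `|f0| + 1.
have M0 : 0 < M by rewrite ltr_wpDl// !addr_ge0.
have : \forall p \near (x0, f0), `|(x0, f0) - p| < Num.min 1 (e / 2 / M).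
  have : (fun p : X * dual X => p) p @[p --> (x0, f0)] --> (x0, f0).
    exact: cvg_id.
  by move/cvgrPdist_lt; apply; rewrite lt_min ltr01/= !divr_gt0.
apply: filterS => -[x f]; rewrite prod_normE/= gt_max !lt_min.
move=> /andP[/andP[x1 xe] /andP[f1 fe]].
have -> : f0 x0 - f x = f0 (x0 - x) + (f0 - f) x.
  have -> : (f0 - f) x = f0 x - f x by [].
  by rewrite linearB/=; lra.
have xM : `|x| <= `|x0| + 1.
  rewrite -[x in leLHS](subKr x0) (le_trans (ler_normB _ _))// lerD2l.
  exact: ltW.
have h1 : `|f0 (x0 - x)| <= e / 2 / M * (`|f0| + 1).
  rewrite (le_trans (ler_dual _ _))// mulrC ler_pM//; first exact: ltW.
  by rewrite lerDl.
have h2 : `|(f0 - f) x| <= e / 2 / M * (`|x0| + 1).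
  by rewrite (le_trans (ler_dual _ _))// ler_pM// ltW.
apply: le_lt_trans (ler_normD _ _) _.
have := lerD h2 h1; rewrite -mulrDr addrA -/M mulfVK ?gt_eqF//; lra.
Qed.

(** A supremum of continuous functions, one for each point of the graph. *)
Lemma fitzpatrick_lsc (alpha : set (X * dual X)) :
  lower_semicontinuous (fun p : X * dual X => fitzpatrick alpha p.1 p.2).
Proof.
move=> p c /ereal_sup_gt[_ [q aq <-]]; rewrite lte_fin => cq.
pose phi (r : X * dual X) : R := r.2 q.1 - q.2 (q.1 - r.1).
have cphi : continuous phi.
  move=> r; apply: cvgB.
    apply: (@continuous_comp _ _ _ (fun r : X * dual X => (q.1, r.2))
      (fun r : X * dual X => r.2 r.1 : R)).
      apply: (@cvg_pair _ _ _ (nbhs r) (nbhs q.1) (nbhs r.2) _ _ _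
        (fun=> q.1) snd); [exact: cvg_cst|exact: cvg_snd].
    exact: pairing_continuous.
  apply: (@continuous_comp _ _ _ (fun r : X * dual X => q.1 - r.1) q.2).
    by apply: cvgB; [exact: cvg_cst|exact: cvg_fst].
  exact: dual_continuous.
exists [set r | c < phi r].
  exact: (@cvgr_gt _ _ (nbhs p) _ phi (phi p) (cphi p) _ cq).
move=> r /= cr; apply: (@lt_le_trans _ _ (phi r)%:E); first by rewrite lte_fin.
by apply: ereal_sup_ubound; exists q.
Qed.

End Pairing.

(** * Measurability of the energy and of its power along a curve *)

Import HBNNSimple.

Section EnergyMeasurability.
Context {R : realType} {X : normedModType R}.
Context {T : R} {E : R -> X -> \bar R} {D : set X}.
Context (E_proper : forall t x, 0 <= t <= T -> (-oo < E t x)%E).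
Context (E_lsc : energy_lsc T E D) (E_time : energy_time_diff T E D).

Lemma energy_fin_num t x : 0 <= t <= T -> D x -> E t x \is a fin_num.
Proof.
case: E_lsc => dom _ _ _ tT Dx.
by rewrite fin_real// E_proper//=; apply/(dom t).
Qed.

(** A convergent difference quotient is bounded near t, so the energy is locally
    Lipschitz at t. *)
Lemma energy_continuous_time t x (s : nat -> R) : 0 <= t <= T -> D x ->
  (forall n, 0 <= s n <= T) -> s n @[n --> \oo] --> t ->
  fine (E (s n) x) @[n --> \oo] --> fine (E t x).
Proof.
move=> tT Dx sT st.
have /cvg_ex[l /cvgrPdist_lt/(_ _ ltr01)] := E_time.1 t x tT Dx.
move=> /nbhs_ballP[d /= d0 Hd]; apply/cvgrPdist_lt => e e0.
have M0 : 0 < `|l| + 1 by rewrite ltr_wpDl.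
have m0 : 0 < Num.min d (e / (`|l| + 1)) by rewrite lt_min d0 divr_gt0.
move/cvgrPdist_lt/(_ _ m0) : st; apply: filterS => n.
rewrite lt_min => /andP[nd ne].
have [->|snt] := eqVneq (s n) t; first by rewrite subrr normr0.
have := Hd (s n) nd snt; rewrite /= in_itv/= => /(_ (sT n)).
rewrite /diff_quotient; set q := _ / _ => lq.
have st0 : s n - t != 0 by rewrite subr_eq0.
have -> : fine (E t x) - fine (E (s n) x) = - (q * (s n - t)).
  by rewrite /q divfK// opprB.
have qM : `|q| < `|l| + 1.
  rewrite -[q](subKr l) (le_lt_trans (ler_normB _ _))// ltrD2l//.
rewrite normrN normrM (distrC (s n)).
apply: (@le_lt_trans _ _ ((`|l| + 1) * `|t - s n|)).
  by rewrite ler_wpM2r// ltW.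
by rewrite mulrC -ltr_pdivlMr.
Qed.

(** The energy is a Caratheodory function: for constant sg the claim is lower
    semicontinuity in space, for simple sg it follows by cutting along the
    values of sg, and in general continuity in time allows approximating sg by
    simple functions with values in [0, T]. *)
Lemma measurable_energy_comp (u : R -> X) (sg : R -> R) :
  strongly_measurable `[0, T] u -> (forall t, 0 <= t <= T -> D (u t)) ->
  measurable_fun `[0, T] sg -> (forall t, 0 <= t <= T -> 0 <= sg t <= T) ->
  measurable_fun `[0, T] (fun t => fine (E (sg t) (u t))).
Proof.
move=> smu Du msg sgT.
have mT : measurable (`[0, T] : set R) by exact: measurable_itv.
have mE a : 0 <= a <= T -> measurable_fun `[0, T] (fun t => fine (E a (u t))).
  case: E_lsc => _ lsc _ _ aT.
  apply: (@measurableT_comp _ _ _ _ _ _ fine _ (fun t => E a (u t))).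
    exact: fine_measurable.
  by apply: measurable_lsc_comp => //; exact: lsc.
have msgE : measurable_fun `[0, T] (fun t => (sg t)%:E).
  exact/measurable_EFinP.
have sg0 t : `[0, T]%classic t -> (0 <= (sg t)%:E)%E.
  by rewrite /= in_itv/= lee_fin => /sgT/andP[].
pose g := nnsfun_approx mT msgE.
have gsg t : 0 <= t <= T -> g n t @[n --> \oo] --> sg t.
  move=> tT; have := @cvg_nnsfun_approx _ _ _ _ mT _ msgE sg0 t.
  by rewrite /= in_itv/= => /(_ tT)/fine_cvgP[_].
have gT n t : 0 <= t <= T -> 0 <= g n t <= T.
  move=> tT; apply/andP; split; first exact: fun_ge0.
  have /andP[_ sT] := sgT t tT; apply: le_trans sT.
  have gc : cvgn (fun n => g n t) by apply/cvg_ex; exists (sg t); exact: gsg.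
  have := cvg_lim (@Rhausdorff R) (gsg t tT) => <-.
  apply: (nondecreasing_cvgn_le (u_ := fun n => g n t)) => // i j ij.
  by have /lefP := nd_nnsfun_approx mT msgE ij; exact.
apply: (measurable_fun_cvg (h := fun n t => fine (E (g n t) (u t))));
  last first.
  move=> t /=; rewrite in_itv/= => tT.
  by apply: energy_continuous_time => //;
    [exact: sgT|exact: Du|move=> n; exact: gT|exact: gsg].
move=> n _ Y mY.
rewrite (_ : _ `&` _ = \bigcup_(a in range (g n) `&` `[0, T])
   (`[0, T] `&` (g n @^-1` [set a]) `&`
    (`[0, T] `&` (fun t => fine (E a (u t))) @^-1` Y))).
  apply: fin_bigcup_measurable; first by apply: finite_setIl; exact: fimfunP.
  move=> a [_ /=]; rewrite in_itv/= => aT; apply: measurableI.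
    apply: measurableI => //.
  exact: mE.
apply/seteqP; split=> [t [tT Yt]|t [a [_ _] [[tT /= <-] [_ ?]]]]; last by split.
exists (g n t); last by split.
split; first by exists t.
by move: tT; rewrite /= !in_itv/=; exact: gT.
Qed.

(** The chain rule expresses this function as a difference of measurable ones
    only almost everywhere, which says nothing for the Borel sigma-algebra; it
    is instead a pointwise limit of difference quotients. *)
Lemma measurable_partial_t (u : R -> X) :
  strongly_measurable `[0, T] u -> (forall t, 0 <= t <= T -> D (u t)) ->
  measurable_fun `[0, T] (fun t => partial_t T E t (u t)).
Proof.
move=> smu Du.
have [T0|T0] := leP 0 T; last first.
  by rewrite set_itv_ge ?bnd_simp -?ltNge//; exact: measurable_fun_set0.
have <- : `[0, T[%classic `|` [set T] = `[0, T]%classic by rewrite setUitv1.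
apply/measurable_funU => //; split; last exact: measurable_fun_set1.
(* steps proportional to T - t keep t + h n t inside [0, T] *)
pose h n t := (T - t) * n.+1%:R^-1.
have hT n t : 0 <= t < T -> 0 < h n t /\ t + h n t <= T.
  move=> /andP[t0 tT]; have Tt : 0 < T - t by rewrite subr_gt0.
  split; first by rewrite mulr_gt0// invr_gt0.
  rewrite -lerBrDl; apply: ler_piMr; first exact: ltW.
  by rewrite invf_le1// ler1n.
pose q n t := diff_quotient E t (u t) (t + h n t).
have mq n : measurable_fun `[0, T[ (q n).
  have oT : `[0, T[ `<=` (`[0, T] : set R).
    by apply: subset_itvl; rewrite bnd_simp.
  apply: measurable_funM.
    apply: measurable_funB; apply: (measurable_funS _ oT) => //.
      apply: measurable_energy_comp => // [|t /andP[t0 tT]].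
        apply: measurable_funD => //; apply: measurable_funM => //.
        exact: measurable_funB.
      rewrite addr_ge0//=; last by rewrite mulr_ge0// subr_ge0.
      rewrite -lerBrDl; apply: ler_piMr; first by rewrite subr_ge0.
      by rewrite invf_le1// ler1n.
    exact: measurable_energy_comp.
  apply: (@measurable_funS _ _ _ _ `]-oo, T[) => //; first exact: subset_itvr.
  apply: open_continuous_measurable_fun => // t; rewrite inE/= in_itv/= => tT.
  apply: cvgV; first by rewrite addrC addKr mulf_neq0// subr_eq0 gt_eqF.
  apply: cvgB; last exact: cvg_id.
  apply: cvgD; first exact: cvg_id.
  by apply: cvgM; [apply: cvgB; [exact: cvg_cst|exact: cvg_id]|exact: cvg_cst].
apply: (measurable_fun_cvg mq) => t /=; rewrite in_itv/= => tT.
have tT' : 0 <= t <= T by case/andP: tT => -> /ltW.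
apply: cvg_trans (E_time.1 t (u t) tT' (Du t tT')) => P.
rewrite nbhs_simpl /= => /nbhs_ballP[d /= d0 Hd].
have : t + h n t @[n --> \oo] --> t.
  rewrite -[X in _ --> X]addr0; apply: cvgD; first exact: cvg_cst.
  rewrite -[X in _ --> X](mulr0 (T - t)); apply: cvgM; first exact: cvg_cst.
  exact: cvg_harmonic.
move=> /cvgrPdist_lt/(_ d d0); apply: filterS => n nd.
have [h0 thT] := hT n t tT.
apply: Hd => //.
  by rewrite gt_eqF// ltrDl.
have /andP[t0 _] := tT.
by rewrite /= in_itv/= thT andbT (addr_ge0 t0)// ltW.
Qed.

End EnergyMeasurability.

(** * The Fitzpatrick function and the graph of a maximal monotone operator *)

Section Fitzpatrick.
Context {R : realType} {X : normedModType R}.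
Implicit Types (alpha : set (X * dual X)) (x : X) (xi : dual X).

(** The Fitzpatrick function minus the pairing measures by how much (x, xi)
    violates monotonicity with respect to the graph. *)
Lemma fitzpatrick_termE x xi (p : X * dual X) :
  xi p.1 - p.2 (p.1 - x) = xi x - (p.2 - xi) (p.1 - x).
Proof.
have -> : (p.2 - xi) (p.1 - x) = p.2 (p.1 - x) - xi (p.1 - x) by [].
by rewrite !linearB/=; lra.
Qed.

Lemma dual_subrr xi x : (xi - xi) x = 0.
Proof. by rewrite -[LHS]/(xi x - xi x) subrr. Qed.

Lemma maximal_monotone_mem alpha x xi : maximal_monotone alpha ->
  (forall p, alpha p -> 0 <= (p.2 - xi) (p.1 - x)) -> alpha (x, xi).
Proof.
move=> [am amax] H; rewrite -(amax (alpha `|` [set (x, xi)])).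
- by right.
- move=> p q [ap|->] [aq|->]; first exact: am.
  + exact: H.
  + have := H q aq; rewrite -(opprB q.1) -(opprB q.2) linearN /= => h.
    by rewrite /= opprK.
  + by rewrite -[leRHS]/((xi - xi) (x - x)) dual_subrr.
- by move=> p ap; left.
Qed.

(** If the supremum were below the pairing, (x, xi) would be monotonically
    related to the graph, hence in it, and its own term would be the pairing. *)
Lemma fitzpatrick_ge alpha x xi :
  maximal_monotone alpha -> ((xi x)%:E <= fitzpatrick alpha x xi)%E.
Proof.
move=> amm; rewrite leNgt; apply/negP => fx.
have lt_f p : alpha p -> xi x - (p.2 - xi) (p.1 - x) < xi x.
  move=> ap; rewrite -lte_fin -fitzpatrick_termE; apply: le_lt_trans fx.
  by apply: ereal_sup_ubound; exists p.
have /lt_f : alpha (x, xi).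
  apply: maximal_monotone_mem => // p /lt_f.
  by rewrite gtrBl; exact: ltW.
by rewrite -[X in _ - X]/((xi - xi) (x - x)) dual_subrr subr0 ltxx.
Qed.

Lemma fitzpatrick_graph alpha x xi : Defs.monotone alpha -> alpha (x, xi) ->
  fitzpatrick alpha x xi = (xi x)%:E.
Proof.
move=> am axxi; apply/eqP; rewrite eq_le; apply/andP; split.
  apply: ge_ereal_sup => _ [p ap <-]; rewrite lee_fin fitzpatrick_termE.
  by rewrite gerBl; exact: (am p (x, xi)).
apply: ereal_sup_ubound; exists (x, xi) => //=.
by rewrite subrr linear0 subr0.
Qed.

Lemma fitzpatrick_eq_mem alpha x xi : maximal_monotone alpha ->
  fitzpatrick alpha x xi = (xi x)%:E -> alpha (x, xi).
Proof.
move=> amm fx; apply: maximal_monotone_mem => // p ap.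
have : ((xi p.1 - p.2 (p.1 - x))%:E <= fitzpatrick alpha x xi)%E.
  by apply: ereal_sup_ubound; exists p.
by rewrite fx lee_fin fitzpatrick_termE gerBl.
Qed.

Lemma fitzpatrick_ge0 alpha x xi : alpha (0, 0) ->
  (0 <= fitzpatrick alpha x xi)%E.
Proof.
move=> a0; apply: ereal_sup_ubound; exists (0, 0) => //=.
by rewrite linear0 sub0r oppr0.
Qed.

End Fitzpatrick.

Lemma ae_itv_oo_cc (R : realType) (T : R) (P : R -> Prop) :
  {ae @lebesgue_measure R, forall t, 0 < t < T -> P t} ->
  {ae @lebesgue_measure R, forall t, `[0, T]%classic t -> P t}.
Proof.
move=> [N [mN N0 PN]]; exists (N `|` [set 0] `|` [set T]); split.
- by apply: measurableU => //; exact: measurableU.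
- rewrite (measureU0 _ _ (lebesgue_measure_set1 T))//; last exact: measurableU.
  by rewrite (measureU0 _ _ (lebesgue_measure_set1 0)).
- move=> t /= Pt.
  have [->|t0] := eqVneq t 0; first by left; right.
  have [->|tT] := eqVneq t T; first by right.
  left; left; apply: PN => /= H; apply: Pt; rewrite in_itv/= => t0T.
  by apply: H; rewrite !lt_def t0 (eq_sym T) tT.
Qed.

Lemma balance_excess_le0 (R : realFieldType) (a b c d e : R) :
  a + b = c + d -> d - b + e <= a - c -> e <= 0.
Proof. lra. Qed.

(** * The two implications *)

Lemma balance_of_increment (R : realFieldType) (a b c d : R) :
  a + b = c - d -> c - a = d + b.
Proof. lra. Qed.

Section Dissipation.
Context {R : realType} {X : normedModType R}.
Local Notation mu := (@lebesgue_measure R).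
Context {T : R} {alpha : set (X * dual X)} {E : R -> X -> \bar R} {D : set X}.
Context (T_gt0 : 0 < T) (alpha_maxmon : maximal_monotone alpha).
Context (alpha00 : alpha (0, 0)).
Context (E_proper : forall t x, 0 <= t <= T -> (-oo < E t x)%E).
Context (E_lsc : energy_lsc T E D) (E_time : energy_time_diff T E D).
Context (E_chain : chain_rule T E alpha).

Lemma energy_domain t x : 0 <= t <= T -> (E t x < +oo)%E -> D x.
Proof. by case: E_lsc => dom _ _ _ tT Etx; apply/(dom t). Qed.

Lemma measurable_dissipation (v : R -> X) (xi : R -> dual X) :
  strongly_measurable `[0, T] v -> strongly_measurable `[0, T] xi ->
  measurable_fun `[0, T] (fun t => fitzpatrick alpha (v t) (- xi t)).
Proof.
move=> mv mxi; apply: (@measurable_lsc_comp _ _ _ (fun t => (v t, - xi t))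
  (fun p : X * dual X => fitzpatrick alpha p.1 p.2)).
- exact: measurable_itv.
- by apply: strongly_measurable_pair => //; exact: strongly_measurableN.
- exact: fitzpatrick_lsc.
Qed.

Lemma measurable_pairing (v : R -> X) (xi : R -> dual X) :
  strongly_measurable `[0, T] v -> strongly_measurable `[0, T] xi ->
  measurable_fun `[0, T] (fun t => xi t (v t) : R).
Proof.
move=> mv mxi; apply: (@measurable_continuous_comp _ _ _ (fun t => (v t, xi t))
  (fun p : X * dual X => p.2 p.1 : R)).
- exact: measurable_itv.
- exact: strongly_measurable_pair.
- exact: pairing_continuous.
Qed.

Lemma energy_identity_solution u du xi : W11 T u du -> L1 T xi ->
  {ae mu, forall t, 0 < t < T -> frechet_subdiff (E t) (u t) (xi t)} ->
  energy_identity T E alpha u du xi -> dni_solution T E alpha u du xi.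
Proof.
move=> W Lxi sub [E0 ipd id].
pose phi t := fitzpatrick alpha (du t) (- xi t).
pose pd t := partial_t T E t (u t).
pose p t : R := xi t (du t).
have mT : measurable (`[0, T] : set R) by exact: measurable_itv.
have [_ [mdu _] _ _] := W; have [mxi _] := Lxi.
have mphi : measurable_fun `[0, T] phi by exact: measurable_dissipation.
have mp : measurable_fun `[0, T] p by exact: measurable_pairing.
have phi0 t : (0 <= phi t)%E by exact: fitzpatrick_ge0.
have intphi0 t : (0 <= \int[mu]_(s in `[0%R, t]) phi s)%E.
  by apply: integral_ge0 => s _.
have TT : 0 <= T <= T by rewrite ltW/=.
have OT : (0 : R) <= 0 <= T by rewrite lexx ltW.
have D0 : D (u 0) by exact: energy_domain E0.
have finpd t : t <= T -> (\int[mu]_(s in `[0%R, t]) (pd s)%:E)%E \is a fin_num.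
  move=> tT; apply: integrable_fin_num => //; apply: integrableS ipd => //.
  by apply: subset_itvl; rewrite bnd_simp.
have finE0 : E 0%R (u 0%R) \is a fin_num.
  exact: (energy_fin_num E_proper E_lsc OT D0).
have Et t : 0 <= t <= T -> (E t (u t) < +oo)%E.
  move=> /andP[]; rewrite le_eqVlt => /predU1P[<- //|t0 tT].
  have /id idt : 0 < t <= T by rewrite t0.
  have : (E t (u t) <= E 0%R (u 0%R) + \int[mu]_(s in `[0%R, t]) (pd s)%:E)%E.
    by rewrite -idt leeDl.
  move=> /le_lt_trans; apply; rewrite ltey_eq fin_numD finE0 finpd//.
have Dut t : 0 <= t <= T -> D (u t).
  by move=> tT; apply: energy_domain (Et t tT).
have finEt t : 0 <= t <= T -> E t (u t) \is a fin_num.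
  by move=> tT; exact: (energy_fin_num E_proper E_lsc tT (Dut t tT)).
have Ebnd : bounded_energy T E u.
  have : (E 0%R (u 0%R) + \int[mu]_(s in `[0%R, T]) `|(pd s)%:E| < +oo)%E.
    have fa : (\int[mu]_(s in `[0%R, T]) `|(pd s)%:E|)%E \is a fin_num.
      by apply: integrable_fin_num => //; exact: integrable_abse ipd.
    by rewrite ltey_eq fin_numD finE0 fa.
  apply: le_lt_trans; apply: ge_ereal_sup => y [t /=].
  rewrite in_itv/= => /andP[t0 tT] <-.
  have intabs0 : (0 <= \int[mu]_(s in `[0%R, T]) `|(pd s)%:E|)%E.
    by apply: integral_ge0.
  move: t0; rewrite le_eqVlt => /predU1P[<-|t0]; first by rewrite leeDl.
  have /id idt : 0 < t <= T by rewrite t0.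
  apply: (@le_trans _ _ (E t (u t) + \int[mu]_(s in `[0%R, t]) phi s)%E).
    by rewrite leeDl.
  rewrite idt leeD2l//.
  have tTs : `[0, t] `<=` (`[0, T] : set R).
    by apply: subset_itvl; rewrite bnd_simp.
  have mpd := measurable_int _ ipd.
  apply: (@le_trans _ _ (\int[mu]_(s in `[0%R, t]) `|(pd s)%:E|)%E).
    apply: le_trans (lee_abs _) _; apply: le_abse_integral => //.
    exact: measurable_funS tTs mpd.
  apply: ge0_subset_integral => //.
  exact: measurableT_comp.
have /id idT : 0 < T <= T by rewrite T_gt0/=.
have intphi : (\int[mu]_(s in `[0%R, T]) phi s < +oo)%E.
  have : (E T (u T) + \int[mu]_(s in `[0%R, T]) phi s < +oo)%E.
    by rewrite idT ltey_eq fin_numD finE0 finpd.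
  rewrite -(fineK (finEt T TT)) => H.
  rewrite ltNge leye_eq; apply/negP => /eqP h.
  by move: H; rewrite h.
have iphi : mu.-integrable `[0, T] phi.
  apply/integrableP; split => //.
  by under eq_integral do rewrite gee0_abs//.
have [gAC gder] := E_chain W Lxi Ebnd sub intphi.
pose f t := fine (phi t).
have aef : {ae mu, forall t, `[0, T]%classic t -> phi t = (f t)%:E}.
  have : {ae mu, forall t, `[0, T]%classic t -> phi t \is a fin_num}.
    exact: integrable_ae.
  apply: filterS.
    exact: (ae_filter_ringOfSetsType mu).
  by move=> t /[apply] /fineK.
have mf : measurable_fun `[0, T] f.
  by apply: measurableT_comp mphi; exact: fine_measurable.
have if_ : mu.-integrable `[0, T] (EFin \o f).
  apply: le_integrable iphi => //; first exact/measurable_EFinP.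
  move=> t _ /=; rewrite /f; have := phi0 t.
  by case: (phi t) => //= r; rewrite ?normr0 ?leey// .
have intf : (\int[mu]_(s in `[0%R, T]) phi s)%E =
    (\int[mu]_(t in `[0, T]) f t)%:E.
  rewrite /Rintegral fineK ?integrable_fin_num//.
  by apply: ae_eq_integral => //; exact/measurable_EFinP.
(* truncating at 1 makes m integrable whatever the size of p; the absolute
   value keeps m nonnegative on the null set where phi is infinite *)
pose m t := Num.min `|f t + p t| 1.
have m0 t : 0 <= m t by rewrite le_min normr_ge0 ler01.
have mm : measurable_fun `[0, T] m.
  apply: measurable_minr => //.
  by apply: measurableT_comp => //; exact: measurable_funD.
have im : mu.-integrable `[0, T] (EFin \o m).
  apply: measurable_bounded_integrable => //.
    by rewrite /= lebesgue_measure_itv/= lte_fin T_gt0 ltry.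
  exists 1; split => // M M1 t _ /=; rewrite ger0_norm//.
  by rewrite (le_trans _ (ltW M1))// ge_min lexx orbT.
pose k t := pd t - f t + m t.
have ipf : mu.-integrable `[0, T] (EFin \o (fun t => pd t - f t)).
  rewrite (_ : _ \o _ = (EFin \o pd) \- (EFin \o f))%E; last exact/funext.
  exact: integrableB.
have ik : mu.-integrable `[0, T] (EFin \o k).
  rewrite (_ : _ \o _ =
    (EFin \o (fun t => pd t - f t)%R) \+ (EFin \o m))%E; last exact/funext.
  exact: integrableD.
have intk : \int[mu]_(t in `[0, T]) k t = \int[mu]_(t in `[0, T]) pd t
    - \int[mu]_(t in `[0, T]) f t + \int[mu]_(t in `[0, T]) m t.
  by rewrite RintegralD// RintegralB.
have : \int[mu]_(t in `[0, T]) k t <= fine (E T (u T)) - fine (E 0%R (u 0%R)).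
  apply: (abs_continuous_le_Rintegral (ltW T_gt0) gAC ik).
  move: gder aef; apply: filterS2; first exact: (ae_filter_ringOfSetsType mu).
  move=> t gt phit t0T; exists (p t + pd t); first exact: gt.
  have fp : 0 <= f t + p t.
    have := @fitzpatrick_ge _ _ alpha (du t) (- xi t) alpha_maxmon.
    rewrite -/(phi t) phit; last first.
      by rewrite /= in_itv/=; case/andP: t0T => /ltW -> /ltW ->.
    by rewrite lee_fin -[leLHS]/(- p t) -subr_ge0 opprK.
  have : m t <= f t + p t by rewrite /m ger0_norm// ge_min lexx.
  rewrite /k; lra.
rewrite intk => mle.
have Rm0 : \int[mu]_(t in `[0, T]) m t <= 0.
  move: idT; rewrite intf -(fineK (finEt T TT)) -(fineK finE0) -EFinD.
  have -> : (\int[mu]_(s in `[0%R, T]) (pd s)%:E)%E =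
      (\int[mu]_(t in `[0, T]) pd t)%:E.
    by rewrite /Rintegral fineK// finpd.
  rewrite -EFinD => -[eT].
  exact: balance_excess_le0 eT mle.
have aem : ae_eq mu (`[0, T]%classic) (EFin \o m) (cst 0%E).
  apply/ae_eq_integral_abs => //; first exact/measurable_EFinP.
  have : (\int[mu]_(t in `[0%R, T]) (m t)%:E)%E = 0%E.
    rewrite -[LHS]fineK; last exact: integrable_fin_num.
    congr (_%:E); apply/eqP; rewrite eq_le Rm0/=; exact: Rintegral_ge0.
  by move=> <-; apply: eq_integral => t _ /=; rewrite ger0_norm.
move: sub; rewrite /dni_solution.
have ae3 : {ae mu, forall t, 0 < t < T -> alpha (du t, - xi t)}.
  move: aef aem; apply: filterS2; first exact: (ae_filter_ringOfSetsType mu).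
  move=> t phit mt t0T; have tT : `[0, T]%classic t.
    by rewrite /= in_itv/=; case/andP: t0T => /ltW -> /ltW ->.
  apply: fitzpatrick_eq_mem => //; rewrite -/(phi t) phit//.
  have [] := mt tT; rewrite /m minEle; case: ifP => _; last first.
    by move=> /eqP; rewrite oner_eq0.
  move=> /normr0_eq0 fp0; congr (_%:E).
  by rewrite -[RHS]/(- p t); lra.
move: ae3; apply: filterS2; first exact: (ae_filter_ringOfSetsType mu).
by move=> t H1 H2 t0T; split; [exact: H1|exact: H2].
Qed.

Lemma solution_energy_identity u du xi : W11 T u du -> L1 T xi ->
  dni_solution T E alpha u du xi -> bounded_energy T E u ->
  (\int[mu]_(t in `[0%R, T]) `|xi t (du t)|%:E < +oo)%E ->
  energy_identity T E alpha u du xi.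
Proof.
move=> W Lxi sol Ebnd ip'.
pose phi t := fitzpatrick alpha (du t) (- xi t).
pose pd t := partial_t T E t (u t).
pose p t : R := xi t (du t).
have mT : measurable (`[0, T] : set R) by exact: measurable_itv.
have [[smu _] [mdu _] _ _] := W; have [mxi _] := Lxi.
have mphi : measurable_fun `[0, T] phi by exact: measurable_dissipation.
have mp : measurable_fun `[0, T] p by exact: measurable_pairing.
have OT : (0 : R) <= 0 <= T by rewrite lexx ltW.
have Esup t : 0 <= t <= T ->
    (E t (u t) <= ereal_sup [set E t (u t) | t in `[0%R, T]])%E.
  by move=> tT; apply: ereal_sup_ubound; exists t => //=; rewrite in_itv/=.
have Et t : 0 <= t <= T -> (E t (u t) < +oo)%E.
  by move=> /Esup/le_lt_trans; apply.
have Dut t : 0 <= t <= T -> D (u t).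
  by move=> tT; apply: energy_domain (Et t tT).
have finEt t : 0 <= t <= T -> E t (u t) \is a fin_num.
  by move=> tT; exact: (energy_fin_num E_proper E_lsc tT (Dut t tT)).
have ip : mu.-integrable `[0, T] (EFin \o p).
  by apply/integrableP; split => //; exact/measurable_EFinP.
have mpd : measurable_fun `[0, T] pd.
  exact: (measurable_partial_t E_lsc E_time smu Dut).
have ipd : mu.-integrable `[0, T] (EFin \o pd).
  apply: measurable_bounded_integrable => //.
    by rewrite /= lebesgue_measure_itv/= lte_fin T_gt0 ltry.
  have [_ [C1 C10 dE]] := E_time.
  pose S := ereal_sup [set E t (u t) | t in `[0%R, T]].
  have finS : S \is a fin_num.
    by rewrite fin_real// (lt_le_trans (E_proper (u 0) OT) (Esup 0 OT)).
  exists (C1 * fine S); split; [exact: num_real|move=> M SM t /=].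
  rewrite in_itv/= => tT.
  apply: le_trans (ltW SM); rewrite -lee_fin EFinM fineK//.
  apply: le_trans (dE _ _ tT (Dut t tT)) _.
  by rewrite lee_pmul2l//; exact: Esup.
have aephi : {ae mu, forall t, `[0, T]%classic t -> phi t = (- p t)%:E}.
  apply: ae_itv_oo_cc; move: sol; apply: filterS.
    exact: (ae_filter_ringOfSetsType mu).
  move=> t H /H[a _]; rewrite /phi (fitzpatrick_graph alpha_maxmon.1 a)//.
have intphi t : t <= T ->
    (\int[mu]_(s in `[0%R, t]) phi s)%E = (- \int[mu]_(s in `[0, t]) p s)%:E.
  move=> tT; have tTs : `[0, t] `<=` (`[0, T] : set R).
    by apply: subset_itvl; rewrite bnd_simp.
  have ipt : mu.-integrable `[0, t] (EFin \o p) by apply: integrableS ip.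
  have iNpt : mu.-integrable `[0, t] (EFin \o (\- p)).
    exact: integrable_EFinN.
  rewrite -RintegralN// /Rintegral fineK; last exact: integrable_fin_num.
  apply: ae_eq_integral => //.
  - exact: measurable_funS tTs mphi.
  - exact: measurable_int iNpt.
  - move: aephi; apply: filterS; first exact: (ae_filter_ringOfSetsType mu).
    by move=> s H /tTs/H ->.
have sub : {ae mu, forall t, 0 < t < T -> frechet_subdiff (E t) (u t) (xi t)}.
  move: sol; apply: filterS; first exact: (ae_filter_ringOfSetsType mu).
  by move=> t H /H[].
have phi_lty : (\int[mu]_(t in `[0%R, T]) phi t < +oo)%E.
  by rewrite intphi// ltry.
have [gAC gder] := E_chain W Lxi Ebnd sub phi_lty.
split => //; first exact: Et.
move=> t /andP[t0 tT].
have tTs : `[0, t] `<=` (`[0, T] : set R).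
  by apply: subset_itvl; rewrite bnd_simp.
have t0T : 0 <= t <= T by rewrite ltW.
have ipt : mu.-integrable `[0, t] (EFin \o p) by apply: integrableS ip.
have ipdt : mu.-integrable `[0, t] (EFin \o pd) by apply: integrableS ipd.
have ik : mu.-integrable `[0, t] (EFin \o (fun s => p s + pd s)).
  rewrite (_ : _ \o _ = (EFin \o p) \+ (EFin \o pd))%E; last exact/funext.
  exact: integrableD.
have : \int[mu]_(s in `[0, t]) (p s + pd s) =
    fine (E t (u t)) - fine (E 0%R (u 0%R)).
  apply: (abs_continuous_Rintegral (ltW t0)
    (abs_continuousS (lexx 0) tT gAC) ik).
  move: gder; apply: filterS; first exact: (ae_filter_ringOfSetsType mu).
  by move=> s H /andP[s0 st]; apply: H; rewrite s0 (lt_le_trans st).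
rewrite RintegralD// => eg; rewrite intphi//.
rewrite -(fineK (finEt t t0T)) -(fineK (finEt 0 OT)).
have -> : (\int[mu]_(s in `[0%R, t]) (pd s)%:E)%E =
    (\int[mu]_(s in `[0, t]) pd s)%:E.
  by rewrite /Rintegral fineK//; exact: integrable_fin_num.
by rewrite -!EFinD; congr (_%:E); exact: balance_of_increment eg.
Qed.

End Dissipation.

Theorem proposition3p12 (R : realType) (X : completeNormedModType R)
    (T : R) (alpha : set (X * dual X)) (E : R -> X -> \bar R) (D : set X)
    (reflX : reflexive_space X) (T_gt0 : 0 < T)
    (alpha_maxmon : maximal_monotone alpha) (alpha00 : alpha (0, 0))
    (E_proper : forall t x, 0 <= t <= T -> (-oo < E t x)%E)
    (E_lsc : energy_lsc T E D)
    (E_coercive : energy_coercive T E)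
    (E_time : energy_time_diff T E D)
    (E_chain : chain_rule T E alpha) :
  (forall (u du : R -> X) (xi : R -> dual X),
     W11 T u du -> L1 T xi ->
     {ae lebesgue_measure, forall t : R, 0 < t < T ->
        frechet_subdiff (E t) (u t) (xi t)} ->
     energy_identity T E alpha u du xi ->
     dni_solution T E alpha u du xi) /\
  (forall (u du : R -> X) (xi : R -> dual X),
     W11 T u du -> L1 T xi ->
     dni_solution T E alpha u du xi ->
     bounded_energy T E u ->
     (\int[lebesgue_measure]_(t in `[0%R, T]) `|xi t (du t)|%:E < +oo)%E ->
     energy_identity T E alpha u du xi).
Proof.
split=> u du xi W Lxi.
- exact: (@energy_identity_solution R X T alpha E D).
- exact: (@solution_energy_identity R X T alpha E D).
Qed.
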